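(* Let $P$ and $Q$ be MIAs with common input alphabet $I$, common output alphabet $O$ and disjoint state sets, and let $p\in P$, $q\in Q$. (i) There exist a MIA $R$ (with input alphabet $I$ and output alphabet $O$) and $r\in R$ with $r\sqsubseteq_{\mathrm{MIA}} p$ and $r\sqsubseteq_{\mathrm{MIA}} q$ if and only if $p\wedge q$ is defined. (ii) If $p\wedge q$ is defined, then for every such MIA $R$ and $r\in R$: $r\sqsubseteq_{\mathrm{MIA}} p$ and $r\sqsubseteq_{\mathrm{MIA}} q$ if and only if $r\sqsubseteq_{\mathrm{MIA}} p\wedge q$.
   Context: A dMTS is $(P,A,\longrightarrow_P,\dashrightarrow_P)$ with states $P$, alphabet $A$ not containing $\tau$, must-relation $\longrightarrow_P\subseteq P\times A\times(2^P\setminus\{\emptyset\})$, may-relation $\dashrightarrow_P\subseteq P\times(A\cup\{\tau\})\times P$, and syntactic consistency ($p\xrightarrow{a}P'$ implies $p\stackrel{a}{\dashrightarrow}p'$ for all $p'\in P'$). A Modal Interface Automaton (MIA) is $(P,I,O,\longrightarrow_P,\dashrightarrow_P)$ with $I,O$ disjoint such that $(P,I\cup O,\longrightarrow_P,\dashrightarrow_P)$ is a dMTS and for all $i\in I$: (a) $p\xrightarrow{i}P'$ and $p\xrightarrow{i}P''$ imply $P'=P''$; (b) $p\stackrel{i}{\dashrightarrow}p'$ implies $p\xrightarrow{i}P'$ for some $P'\ni p'$. Write $p\xrightarrow{a}$ ($p\stackrel{a}{\dashrightarrow}$) if some must- (may-) $a$-transition leaves $p$. Weak may: $p\stackrel{\epsilon}{\Longrightarrow}p'$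 iff $p(\stackrel{\tau}{\dashrightarrow})^*p'$; $p\stackrel{\alpha}{\Longrightarrow}p'$ iff $\exists p''.\,p\stackrel{\epsilon}{\Longrightarrow}p''\stackrel{\alpha}{\dashrightarrow}p'$; $p\stackrel{\alpha}{\Longrightarrow}$ if such $p'$ exists; $\hat\tau=\epsilon$, $\hat a=a$. For MIAs $P,Q$ with the same $I,O$, $\mathcal R\subseteq P\times Q$ is a MIA-refinement relation if for all $(p,q)\in\mathcal R$: (i) $q\xrightarrow{a}Q'$ ($a\in I\cup O$) implies some $P'$ with $p\xrightarrow{a}P'$ and $\forall p'\in P'\,\exists q'\in Q'.\,(p',q')\in\mathcal R$; (ii) $p\stackrel{\alpha}{\dashrightarrow}p'$ with $\alpha\in O\cup\{\tau\}$ implies some $q'$ with $q\stackrel{\hat\alpha}{\Longrightarrow}q'$ and $(p',q')\in\mathcal R$. $p\sqsubseteq_{\mathrm{MIA}}q$ iff some such relation contains $(p,q)$. Conjunctive product $P\& Q$: state set $(P\times Q)\cup P\cup Q$, inheriting the transitions of $P$ and $Q$, plus, for $i\in I$, $o\in O$, $\alpha\in O\cup\{\tau\}$: (OMust1) $(p,q)\xrightarrow{o}\{(p',q'):p'\in P',q\stackrel{o}{\Longrightarrow}_Qq'\}$ if $p\xrightarrow{o}_PP'$ and $q\stackrel{o}{\Longrightarrow}_Q$; (OMust2) $(p,q)\xrightarrow{o}\{(p',q'):p\stackrel{o}{\Longrightarrow}_Pp',q'\in Q'\}$ if $p\stackrel{o}{\Longrightarrow}_P$ and $q\xrightarrow{o}_QQ'$;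 (IMust1) $(p,q)\xrightarrow{i}P'$ if $p\xrightarrow{i}_PP'$ and no $i$-must from $q$; (IMust2) $(p,q)\xrightarrow{i}Q'$ if no $i$-must from $p$ and $q\xrightarrow{i}_QQ'$; (IMust3) $(p,q)\xrightarrow{i}P'\times Q'$ if $p\xrightarrow{i}_PP'$ and $q\xrightarrow{i}_QQ'$; (May1) $(p,q)\stackrel{\tau}{\dashrightarrow}(p',q)$ if $p\stackrel{\tau}{\Longrightarrow}_Pp'$; (May2) $(p,q)\stackrel{\tau}{\dashrightarrow}(p,q')$ if $q\stackrel{\tau}{\Longrightarrow}_Qq'$; (May3) $(p,q)\stackrel{\alpha}{\dashrightarrow}(p',q')$ if $p\stackrel{\alpha}{\Longrightarrow}_Pp'$ and $q\stackrel{\alpha}{\Longrightarrow}_Qq'$; (IMay1) $(p,q)\stackrel{i}{\dashrightarrow}p'$ if $p\stackrel{i}{\dashrightarrow}_Pp'$ and no $i$-may from $q$; (IMay2) $(p,q)\stackrel{i}{\dashrightarrow}q'$ if no $i$-may from $p$ and $q\stackrel{i}{\dashrightarrow}_Qq'$; (IMay3) $(p,q)\stackrel{i}{\dashrightarrow}(p',q')$ if $p\stackrel{i}{\dashrightarrow}_Pp'$ and $q\stackrel{i}{\dashrightarrow}_Qq'$. The set $F\subseteq P\times Q$ of inconsistent states is the least set with: (F1) $p\xrightarrow{o}_P$, not $q\stackrel{o}{\Longrightarrow}_Q$, $o\in O$ imply $(p,q)\in F$; (F2) not $p\stackrel{o}{\Longrightarrow}_P$, $q\xrightarrow{o}_Q$,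 $o\in O$ imply $(p,q)\in F$; (F3) $(p,q)\xrightarrow{a}R'$ in $P\& Q$ with $R'\subseteq F$ implies $(p,q)\in F$. The conjunction $P\wedge Q$ is the MIA obtained from $P\& Q$ by deleting all states in $F$, all transitions leaving deleted states, all may-transitions entering deleted states, and removing deleted states from targets of must-transitions. The state $(p,q)$ of $P\wedge Q$ is written $p\wedge q$; $p\wedge q$ is defined iff $(p,q)\notin F$. *)

(* Defs.v *)
From mathcomp Require Import all_boot.
From mathcomp Require Import boolp classical_sets.
From Stdlib Require Import Relations.

Set Implicit Arguments.
Unset Strict Implicit.
Unset Printing Implicit Defensive.

Local Open Scope classical_set_scope.

(* A may-label is an [option A]: [Some a] is the visible action [a] and [None]
   is tau, which is thereby not a member of the alphabet. *)
Record dMTS (A : Type) := DMTS {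
  state :> Type;
  must : state -> A -> set state -> Prop;
  may : state -> option A -> state -> Prop;
  must_nonempty : forall p a P', must p a P' -> P' !=set0;
  must_may : forall p a P', must p a P' -> forall p', P' p' -> may p (Some a) p'
}.
Arguments must {A d}.
Arguments may {A d}.

Definition can_must (A : Type) (P : dMTS A) (p : P) (a : A) : Prop :=
  exists P', must p a P'.

Definition can_may (A : Type) (P : dMTS A) (p : P) (a : option A) : Prop :=
  exists p', may p a p'.

Definition weak_eps (A : Type) (P : dMTS A) : P -> P -> Prop :=
  clos_refl_trans P (fun p p' => may p None p').

(* No trailing tau-steps are allowed after the [a]-step. *)
Definition weak_may (A : Type) (P : dMTS A) (p : P) (a : option A) (p' : P) :
    Prop :=
  exists p'', weak_eps p p'' /\ may p'' a p'.

Definition can_weak_may (A : Type) (P : dMTS A) (p : P) (a : option A) : Prop :=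
  exists p', weak_may p a p'.

Definition weak_hat (A : Type) (P : dMTS A) (p : P) (a : option A) (p' : P) :
    Prop :=
  if a is Some _ then weak_may p a p' else weak_eps p p'.

(* The alphabet is the sum type [I + O], which makes inputs and outputs
   disjoint. *)
Record MIA (I O : Type) := Mia {
  mia_dMTS :> dMTS (I + O);
  input_det : forall (p : mia_dMTS) (i : I) P' P'',
    must p (inl i) P' -> must p (inl i) P'' -> P' = P'';
  input_may_must : forall (p : mia_dMTS) (i : I) p',
    may p (Some (inl i)) p' -> exists P', must p (inl i) P' /\ P' p'
}.

Definition out_tau (I O : Type) (alpha : option O) : option (I + O) :=
  omap inr alpha.
Arguments out_tau I {O} alpha.

Definition MIA_refinement (I O : Type) (P Q : MIA I O) (R : P -> Q -> Prop) :
    Prop :=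
  forall p q, R p q ->
    (forall (a : I + O) Q', must q a Q' ->
       exists P', must p a P' /\
         forall p', P' p' -> exists q', Q' q' /\ R p' q') /\
    (forall (alpha : option O) p', may p (out_tau I alpha) p' ->
       exists q', weak_hat q (out_tau I alpha) q' /\ R p' q').

Definition refines (I O : Type) (P Q : MIA I O) (p : P) (q : Q) : Prop :=
  exists R : P -> Q -> Prop, MIA_refinement R /\ R p q.

(* The states (P x Q) u P u Q of the conjunctive product; the constructors tag
   the three components, so they are disjoint. *)
Inductive prod_state (P Q : Type) : Type :=
  | Both (p : P) (q : Q)
  | InL (p : P)
  | InR (q : Q).
Arguments Both {P Q} p q.
Arguments InL {P Q} p.
Arguments InR {P Q} q.

Inductive prod_must (I O : Type) (P Q : MIA I O) :
    prod_state P Q -> I + O -> set (prod_state P Q) -> Prop :=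
  | MustL p a P' : must p a P' -> prod_must (InL p) a (InL @` P')
  | MustR q a Q' : must q a Q' -> prod_must (InR q) a (InR @` Q')
  | OMust1 p q (o : O) P' :
      must p (inr o) P' -> can_weak_may q (Some (inr o)) ->
      prod_must (Both p q) (inr o)
        [set Both p' q' | p' in P' & q' in weak_may q (Some (inr o))]
  | OMust2 p q (o : O) Q' :
      can_weak_may p (Some (inr o)) -> must q (inr o) Q' ->
      prod_must (Both p q) (inr o)
        [set Both p' q' | p' in weak_may p (Some (inr o)) & q' in Q']
  | IMust1 p q (i : I) P' :
      must p (inl i) P' -> ~ can_must q (inl i) ->
      prod_must (Both p q) (inl i) (InL @` P')
  | IMust2 p q (i : I) Q' :
      ~ can_must p (inl i) -> must q (inl i) Q' ->
      prod_must (Both p q) (inl i) (InR @` Q')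
  | IMust3 p q (i : I) P' Q' :
      must p (inl i) P' -> must q (inl i) Q' ->
      prod_must (Both p q) (inl i) [set Both p' q' | p' in P' & q' in Q'].

Inductive prod_may (I O : Type) (P Q : MIA I O) :
    prod_state P Q -> option (I + O) -> prod_state P Q -> Prop :=
  | MayL p a p' : may p a p' -> prod_may (InL p) a (InL p')
  | MayR q a q' : may q a q' -> prod_may (InR q) a (InR q')
  | May1 p q p' :
      weak_may p None p' -> prod_may (Both p q) None (Both p' q)
  | May2 p q q' :
      weak_may q None q' -> prod_may (Both p q) None (Both p q')
  | May3 p q (alpha : option O) p' q' :
      weak_may p (out_tau I alpha) p' -> weak_may q (out_tau I alpha) q' ->
      prod_may (Both p q) (out_tau I alpha) (Both p' q')
  | IMay1 p q (i : I) p' :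
      may p (Some (inl i)) p' -> ~ can_may q (Some (inl i)) ->
      prod_may (Both p q) (Some (inl i)) (InL p')
  | IMay2 p q (i : I) q' :
      ~ can_may p (Some (inl i)) -> may q (Some (inl i)) q' ->
      prod_may (Both p q) (Some (inl i)) (InR q')
  | IMay3 p q (i : I) p' q' :
      may p (Some (inl i)) p' -> may q (Some (inl i)) q' ->
      prod_may (Both p q) (Some (inl i)) (Both p' q').

Lemma prod_must_nonempty (I O : Type) (P Q : MIA I O) (s : prod_state P Q) a S :
  prod_must s a S -> S !=set0.
Proof.
move=> h; case: s a S / h.
- by move=> p a P' h; have [p' ?] := must_nonempty h; exists (InL p'), p'.
- by move=> q a Q' h; have [q' ?] := must_nonempty h; exists (InR q'), q'.
- move=> p q o P' h [q' h']; have [p' ?] := must_nonempty h.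
  by exists (Both p' q'), p' => //; exists q'.
- move=> p q o Q' [p' h'] h; have [q' ?] := must_nonempty h.
  by exists (Both p' q'), p' => //; exists q'.
- by move=> p q i P' h _; have [p' ?] := must_nonempty h; exists (InL p'), p'.
- by move=> p q i Q' _ h; have [q' ?] := must_nonempty h; exists (InR q'), q'.
- move=> p q i P' Q' h h'.
  have [p' ?] := must_nonempty h; have [q' ?] := must_nonempty h'.
  by exists (Both p' q'), p' => //; exists q'.
Qed.

Lemma may_weak_may (A : Type) (P : dMTS A) (p : P) a p' :
  may p a p' -> weak_may p a p'.
Proof. by move=> h; exists p; split=> //; exact: rt_refl. Qed.

Lemma not_can_may (I O : Type) (P : MIA I O) (p : P) (i : I) :
  ~ can_must p (inl i) -> ~ can_may p (Some (inl i)).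
Proof.
move=> h [p' hp']; apply: h; have [P' [hP' _]] := input_may_must hp'.
by exists P'.
Qed.

Lemma not_can_must (I O : Type) (P : MIA I O) (p : P) (i : I) :
  ~ can_may p (Some (inl i)) -> ~ can_must p (inl i).
Proof.
move=> h [P' hP']; apply: h; have [p' hp'] := must_nonempty hP'.
by exists p'; exact: must_may hP' _ hp'.
Qed.

Lemma prod_must_may (I O : Type) (P Q : MIA I O) (s : prod_state P Q) a S :
  prod_must s a S -> forall s', S s' -> prod_may s (Some a) s'.
Proof.
move=> h; case: s a S / h.
- by move=> p a P' h _ [p' hp' <-]; apply: MayL; exact: must_may h _ hp'.
- by move=> q a Q' h _ [q' hq' <-]; apply: MayR; exact: must_may h _ hq'.
- move=> p q o P' h _ _ [p' hp' [q' hq' <-]].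
  by apply: (May3 (alpha := Some o)) hq'; apply: may_weak_may; exact: must_may h _ hp'.
- move=> p q o Q' _ h _ [p' hp' [q' hq' <-]].
  apply: (May3 (alpha := Some o)); first exact: hp'.
  by apply: may_weak_may; exact: must_may h _ hq'.
- move=> p q i P' h hn _ [p' hp' <-].
  by apply: IMay1; [exact: must_may h _ hp'|exact: not_can_may].
- move=> p q i Q' hn h _ [q' hq' <-].
  by apply: IMay2; [exact: not_can_may|exact: must_may h _ hq'].
- move=> p q i P' Q' hp hq _ [p' hp' [q' hq' <-]].
  by apply: IMay3; [exact: must_may hp _ hp'|exact: must_may hq _ hq'].
Qed.

Definition prod_dMTS (I O : Type) (P Q : MIA I O) : dMTS (I + O) :=
  DMTS (@prod_must_nonempty I O P Q) (@prod_must_may I O P Q).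

(* Contains only [Both]-states, i.e. is a subset of P x Q. *)
Inductive inconsistent (I O : Type) (P Q : MIA I O) : prod_state P Q -> Prop :=
  | F1 p q (o : O) :
      can_must p (inr o) -> ~ can_weak_may q (Some (inr o)) ->
      inconsistent (Both p q)
  | F2 p q (o : O) :
      ~ can_weak_may p (Some (inr o)) -> can_must q (inr o) ->
      inconsistent (Both p q)
  | F3 p q (a : I + O) R' :
      prod_must (Both p q) a R' -> (forall s, R' s -> inconsistent s) ->
      inconsistent (Both p q).

Lemma prod_input_det (I O : Type) (P Q : MIA I O) (s : prod_dMTS P Q) (i : I)
    S S' :
  must s (inl i) S -> must s (inl i) S' -> S = S'.
Proof.
rewrite /=; move ea : (inl i) => a h; case: s a S / h ea.
- move=> p a P' h ea h'; rewrite -{}ea in h h'.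
  by inversion h'; subst; rewrite (input_det h (P'' := P'0)).
- move=> q a Q' h ea h'; rewrite -{}ea in h h'.
  by inversion h'; subst; rewrite (input_det h (P'' := Q'0)).
- by [].
- by [].
- move=> p q j P' h hn [ej] h'; subst j.
  inversion h' as [| | | |? ? ? P'' h1 h2|? ? ? ? h1 h2|? ? ? ? Q' h1 h2]; subst.
  + by rewrite (input_det h h1).
  + by case: h1; exists P'.
  + by case: hn; exists Q'.
- move=> p q j Q' hn h [ej] h'; subst j.
  inversion h' as [| | | |? ? ? P'' h1 h2|? ? ? ? h1 h2|? ? ? ? Q'' h1 h2]; subst.
  + by case: h2; exists Q'.
  + by rewrite (input_det h h2).
  + by case: hn; eexists; exact: h1.
- move=> p q j P' Q' hp hq [ej] h'; subst j.
  inversion h' as [| | | |? ? ? P'' h1 h2|? ? ? ? h1 h2|? ? ? ? Q'' h1 h2]; subst.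
  + by case: h2; exists Q'.
  + by case: h1; exists P'.
  + by rewrite (input_det hp h1) (input_det hq h2).
Qed.

Lemma prod_input_may_must (I O : Type) (P Q : MIA I O) (s : prod_dMTS P Q)
    (i : I) s' :
  may s (Some (inl i)) s' -> exists S, must s (inl i) S /\ S s'.
Proof.
rewrite /=; move ea : (Some (inl i)) => a h; case: s a s' / h ea => //.
- move=> p a p' h ea; rewrite -{}ea in h.
  have [P' [hP' hp']] := input_may_must h.
  by exists (InL @` P'); split; [exact: MustL|exists p'].
- move=> q a q' h ea; rewrite -{}ea in h.
  have [Q' [hQ' hq']] := input_may_must h.
  by exists (InR @` Q'); split; [exact: MustR|exists q'].
- by move=> p q [].
- move=> p q j p' h hn [ej]; subst j.
  have [P' [hP' hp']] := input_may_must h.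
  by exists (InL @` P'); split; [apply: IMust1 => //; exact: not_can_must|exists p'].
- move=> p q j q' hn h [ej]; subst j.
  have [Q' [hQ' hq']] := input_may_must h.
  by exists (InR @` Q'); split; [apply: IMust2 => //; exact: not_can_must|exists q'].
- move=> p q j p' q' h h' [ej]; subst j.
  have [P' [hP' hp']] := input_may_must h.
  have [Q' [hQ' hq']] := input_may_must h'.
  exists [set Both p' q' | p' in P' & q' in Q'].
  by split; [exact: IMust3|exists p' => //; exists q'].
Qed.

Definition conj_product (I O : Type) (P Q : MIA I O) : MIA I O :=
  Mia (@prod_input_det I O P Q) (@prod_input_may_must I O P Q).

Definition conj_state (I O : Type) (P Q : MIA I O) : Type :=
  {s : conj_product P Q | ~ inconsistent s}.

Definition conj_must (I O : Type) (P Q : MIA I O) (s : conj_state P Q)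
    (a : I + O) (S : set (conj_state P Q)) : Prop :=
  exists R', must (proj1_sig s) a R' /\ S = [set s' | R' (proj1_sig s')].

Definition conj_may (I O : Type) (P Q : MIA I O) (s : conj_state P Q)
    (a : option (I + O)) (s' : conj_state P Q) : Prop :=
  may (proj1_sig s) a (proj1_sig s').

Lemma conj_must_nonempty (I O : Type) (P Q : MIA I O) (s : conj_state P Q) a S :
  conj_must s a S -> S !=set0.
Proof.
move=> [R' [hR' ->]]; apply: contrapT => hS.
have hF t : R' t -> inconsistent t.
  by move=> ht; apply: contrapT => hn; apply: hS; exists (exist _ t hn).
have [t ht] := must_nonempty hR'.
case: s hR' => -[p q|p|q] hs /= hR'; first exact: hs (F3 hR' hF).
- by inversion hR'; subst; case: ht (hF _ ht) => p' _ <- h; inversion h.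
- by inversion hR'; subst; case: ht (hF _ ht) => q' _ <- h; inversion h.
Qed.

Lemma conj_must_may (I O : Type) (P Q : MIA I O) (s : conj_state P Q) a S :
  conj_must s a S -> forall s', S s' -> conj_may s (Some a) s'.
Proof. by move=> [R' [hR' ->]] s' hs'; exact: must_may hR' _ hs'. Qed.

Definition conj_dMTS (I O : Type) (P Q : MIA I O) : dMTS (I + O) :=
  DMTS (@conj_must_nonempty I O P Q) (@conj_must_may I O P Q).

Lemma conj_input_det (I O : Type) (P Q : MIA I O) (s : conj_dMTS P Q) (i : I)
    S S' :
  must s (inl i) S -> must s (inl i) S' -> S = S'.
Proof.
by move=> [R1 [h1 ->]] [R2 [h2 ->]]; rewrite (input_det h1 h2).
Qed.

Lemma conj_input_may_must (I O : Type) (P Q : MIA I O) (s : conj_dMTS P Q)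
    (i : I) s' :
  may s (Some (inl i)) s' -> exists S, must s (inl i) S /\ S s'.
Proof.
move=> hs; have [R' [h h']] := input_may_must hs.
by exists [set s' | R' (proj1_sig s')]; split=> //; exists R'.
Qed.

Definition conjunction (I O : Type) (P Q : MIA I O) : MIA I O :=
  Mia (@conj_input_det I O P Q) (@conj_input_may_must I O P Q).

Definition conj_defined (I O : Type) (P Q : MIA I O) (p : P) (q : Q) : Prop :=
  ~ inconsistent (Both p q).

Definition conj_at (I O : Type) (P Q : MIA I O) (p : P) (q : Q)
    (h : conj_defined p q) : conjunction P Q :=
  exist (fun s : conj_product P Q => ~ inconsistent s) (Both p q) h.

(* Main.v *)
Require Import Defs.
From mathcomp Require Import all_boot.
From mathcomp Require Import boolp classical_sets.
From Stdlib Require Import Relations.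

(** Refinement is transitive, and [p /\ q] refines both [p] and [q] because
consistency rules out exactly the outputs that only one side may perform.
Conversely, a common refinement [r] of [p] and [q] can match every
must-transition of [(p, q)] by one whose targets again refine some target pair;
since must-targets are nonempty, induction on inconsistency shows that [(p, q)]
is consistent, and the same matching makes "refines both components" a
refinement relation into the conjunction. *)

Set Implicit Arguments.
Unset Strict Implicit.
Unset Printing Implicit Defensive.

(** * Weak moves and transitivity of refinement *)

Section Refinement.
Context {I O : Type}.

(** The witnessing relation also relates the successors, so [refines] itself satisfies both clauses
    of a refinement relation; here the must clause. *)
Lemma refines_must (P Q : MIA I O) (p : P) (q : Q) (a : I + O) Q' :
  refines p q -> must q a Q' ->
  exists P', must p a P' /\
    forall p', P' p' -> exists q', Q' q' /\ refines p' q'.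
Proof.
move=> [S [hS hpq]] /((hS _ _ hpq).1 a Q') [P' [hP' h]]; exists P'; split=> //.
by move=> p' /h [q' [hq' hS']]; exists q'; split=> //; exists S.
Qed.

Lemma refines_may (P Q : MIA I O) (p : P) (q : Q) (alpha : option O) p' :
  refines p q -> may p (out_tau I alpha) p' ->
  exists q', weak_hat q (out_tau I alpha) q' /\ refines p' q'.
Proof.
move=> [S [hS hpq]] /((hS _ _ hpq).2 alpha p') [q' [hq' hS']].
by exists q'; split=> //; exists S.
Qed.

Lemma weak_eps_may (A : Type) (P : dMTS A) (p p' : P) a p'' :
  weak_eps p p' -> weak_may p' a p'' -> weak_may p a p''.
Proof. by move=> h [x [hx ha]]; exists x; split=> //; exact: rt_trans h hx. Qed.

Lemma may_weak_hat (A : Type) (P : dMTS A) (p : P) a p' :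
  may p a p' -> weak_hat p a p'.
Proof. by case: a => [a|] h /=; [exact: may_weak_may|exact: rt_step]. Qed.

Lemma weak_may_hat (A : Type) (P : dMTS A) (p : P) a p' :
  weak_may p a p' -> weak_hat p a p'.
Proof.
by case: a => [a|] //= [x [hx h]]; apply: rt_trans hx _; exact: rt_step.
Qed.

(** The tau-rules of the product require a nonempty path on each side that moves, so the empty path
    has to be split off. *)
Lemma weak_eps_cases (A : Type) (P : dMTS A) (p p' : P) :
  weak_eps p p' -> p = p' \/ weak_may p None p'.
Proof.
move=> /clos_rt_rtn1_iff; elim=> [|x y hxy hpx _]; first by left.
by right; exists x; split=> //; exact/clos_rt_rtn1_iff.
Qed.

Lemma refines_weak_eps (P Q : MIA I O) (p p' : P) (q : Q) :
  refines p q -> weak_eps p p' -> exists q', weak_eps q q' /\ refines p' q'.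
Proof.
move=> hpq /clos_rt_rtn1_iff; elim=> [|x y hxy _ [q' [hq' hx]]].
  by exists q; split=> //; exact: rt_refl.
have [q'' [hq'' hy]] := refines_may (alpha := None) hx hxy.
by exists q''; split=> //; exact: rt_trans hq' hq''.
Qed.

(** A visible weak move has no trailing tau-steps: it suffices to simulate the leading ones and then
    the single visible step. *)
Lemma refines_weak_hat (P Q : MIA I O) (p p' : P) (q : Q) (alpha : option O) :
  refines p q -> weak_hat p (out_tau I alpha) p' ->
  exists q', weak_hat q (out_tau I alpha) q' /\ refines p' q'.
Proof.
case: alpha => [o|] hpq; last exact: refines_weak_eps.
move=> [x [hpx hx]].
have [y [hqy hxy]] := refines_weak_eps hpq hpx.
have [q' [hyq' h]] := refines_may (alpha := Some o) hxy hx.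
by exists q'; split=> //; exact: weak_eps_may hqy hyq'.
Qed.

(** The relational composite is the witness. The middle state answers a may-step by a weak move,
    which is why weak moves must be simulated too. *)
Lemma refines_trans (P Q R : MIA I O) (p : P) (q : Q) (r : R) :
  refines p q -> refines q r -> refines p r.
Proof.
move=> hpq hqr; exists (fun x z => exists y : Q, refines x y /\ refines y z).
split; last by exists q.
move=> x z [y [hxy hyz]]; split=> [a R' hR'|alpha x' hx'].
  have [Q' [hQ' hQR]] := refines_must hyz hR'.
  have [P' [hP' hPQ]] := refines_must hxy hQ'.
  exists P'; split=> // x' /hPQ [y' [/hQR [z' [hz' hyz']] hxy']].
  by exists z'; split=> //; exists y'.
have [y' [hy' hxy']] := refines_may hxy hx'.
have [z' [hz' hyz']] := refines_weak_hat hyz hy'.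
by exists z'; split=> //; exists y'.
Qed.

End Refinement.

(** * The conjunction refines both components *)

Section Conjunction.
Context {I O : Type} {P Q : MIA I O}.

(** The refinement relation from the conjunction to [P]. [InR] states need no image: from a pair
    they are reached only by inputs that the left state cannot take, and neither refinement clause
    follows such a step. *)
Definition projects_left (s : prod_state P Q) (p : P) : Prop :=
  match s with Both x _ | InL x => x = p | InR _ => False end.

Definition projects_right (s : prod_state P Q) (q : Q) : Prop :=
  match s with Both _ y | InR y => y = q | InL _ => False end.

Lemma projects_left_may (s s' : prod_state P Q) p (alpha : option O) :
  projects_left s p -> prod_may s (out_tau I alpha) s' ->
  exists p', weak_hat p (out_tau I alpha) p' /\ projects_left s' p'.
Proof.
move ea : (out_tau I alpha) => a hs h; case: s a s' / h hs ea => //=.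
- by move=> x a x' h <- _; exists x'; split=> //; exact: may_weak_hat.
- move=> x y x' h <- _; exists x'; split=> //.
  exact: (weak_may_hat (a := None)).
- by move=> x y y' _ <- _; exists x; split=> //; exact: rt_refl.
- by move=> x y b x' y' h _ <- _; exists x'; split=> //; exact: weak_may_hat.
(* [out_tau] never yields an input, so the input rules are vacuous. *)
- by case: alpha.
- by case: alpha.
- by case: alpha.
Qed.

(** For outputs, consistency excludes [F1], so the other side can follow weakly and [OMust1]
    applies. For inputs, [IMust3] or [IMust1] applies according to whether the other side has a
    must-transition. *)
Lemma projects_left_must (s : prod_state P Q) p a P' :
  ~ inconsistent s -> projects_left s p -> must p a P' ->
  exists S, prod_must s a S /\
    forall t, S t -> exists p', P' p' /\ projects_left t p'.
Proof.
case: s => [x y|x|//] hc /= <- {p}; last first.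
  exists (InL @` P')%classic; split; first exact: MustL.
  by move=> _ [p' hp' <-]; exists p'.
case: a => [i|o] hP'; last first.
  have hy : can_weak_may y (Some (inr o)).
    by apply: contrapT => hy; apply: hc; apply: (F1 (o := o)) hy; exists P'.
  eexists; split; first exact: OMust1 hP' hy.
  by move=> _ [p' hp' [q' _ <-]]; exists p'.
have [[Q' hQ']|hQ] := pselect (can_must y (inl i)); eexists; split.
- exact: IMust3 hP' hQ'.
- by move=> _ [p' hp' [q' _ <-]]; exists p'.
- exact: IMust1 hP' hQ.
- by move=> _ [p' hp' <-]; exists p'.
Qed.

Lemma projects_left_refines (s : conjunction P Q) p :
  projects_left (proj1_sig s) p -> refines s p.
Proof.
move=> hs; exists (fun t x => projects_left (proj1_sig t) x); split=> //.
move=> t x ht; split=> [a P' hP'|alpha t' ht']; last first.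
  exact: projects_left_may ht ht'.
have [S [hS hSP]] := projects_left_must (proj2_sig t) ht hP'.
(* Deleting inconsistent targets is harmless, since every target projects into [P']. *)
exists [set t' : conjunction P Q | S (proj1_sig t')]%classic.
by split; [exists S|move=> t' /hSP].
Qed.

Lemma projects_right_may (s s' : prod_state P Q) q (alpha : option O) :
  projects_right s q -> prod_may s (out_tau I alpha) s' ->
  exists q', weak_hat q (out_tau I alpha) q' /\ projects_right s' q'.
Proof.
move ea : (out_tau I alpha) => a hs h; case: s a s' / h hs ea => //=.
- by move=> y a y' h <- _; exists y'; split=> //; exact: may_weak_hat.
- by move=> x y x' _ <- _; exists y; split=> //; exact: rt_refl.
- move=> x y y' h <- _; exists y'; split=> //.
  exact: (weak_may_hat (a := None)).
- by move=> x y b x' y' _ h <- _; exists y'; split=> //; exact: weak_may_hat.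
- by case: alpha.
- by case: alpha.
- by case: alpha.
Qed.

Lemma projects_right_must (s : prod_state P Q) q a Q' :
  ~ inconsistent s -> projects_right s q -> must q a Q' ->
  exists S, prod_must s a S /\
    forall t, S t -> exists q', Q' q' /\ projects_right t q'.
Proof.
case: s => [x y|//|y] hc /= <- {q}; last first.
  exists (InR @` Q')%classic; split; first exact: MustR.
  by move=> _ [q' hq' <-]; exists q'.
case: a => [i|o] hQ'; last first.
  have hx : can_weak_may x (Some (inr o)).
    by apply: contrapT => hx; apply: hc; apply: (F2 (o := o)) hx _; exists Q'.
  eexists; split; first exact: OMust2 hx hQ'.
  by move=> _ [p' _ [q' hq' <-]]; exists q'.
have [[P' hP']|hP] := pselect (can_must x (inl i)); eexists; split.
- exact: IMust3 hP' hQ'.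
- by move=> _ [p' _ [q' hq' <-]]; exists q'.
- exact: IMust2 hP hQ'.
- by move=> _ [q' hq' <-]; exists q'.
Qed.

Lemma projects_right_refines (s : conjunction P Q) q :
  projects_right (proj1_sig s) q -> refines s q.
Proof.
move=> hs; exists (fun t y => projects_right (proj1_sig t) y); split=> //.
move=> t y ht; split=> [a Q' hQ'|alpha t' ht']; last first.
  exact: projects_right_may ht ht'.
have [S [hS hSQ]] := projects_right_must (proj2_sig t) ht hQ'.
exists [set t' : conjunction P Q | S (proj1_sig t')]%classic.
by split; [exists S|move=> t' /hSQ].
Qed.

(** * Common refinements refine the conjunction *)

Definition refines_components (R : MIA I O) (r : R) (s : prod_state P Q) :
    Prop :=
  match s with
  | Both p q => refines r p /\ refines r q
  | InL p => refines r p
  | InR q => refines r q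
  end.

(** An output is matched through the side that owns the must-transition; each target is then also a
    may-successor of [r], which the other side answers weakly. *)
Lemma refines_components_must (R : MIA I O) (r : R) s a S :
  refines_components r s -> prod_must s a S ->
  exists R', must r a R' /\
    forall r', R' r' -> exists s', S s' /\ refines_components r' s'.
Proof.
move=> hr h; case: s a S / h hr => /=.
- move=> p a P' hP' /refines_must - /(_ _ _ hP') [R' [hR' h]].
  exists R'; split=> // r' /h [p' [hp' hr']].
  by exists (InL p'); split=> //; exists p'.
- move=> q a Q' hQ' /refines_must - /(_ _ _ hQ') [R' [hR' h]].
  exists R'; split=> // r' /h [q' [hq' hr']].
  by exists (InR q'); split=> //; exists q'.
- move=> p q o P' hP' _ [hp hq]; have [R' [hR' h]] := refines_must hp hP'.
  exists R'; split=> // r' hr'; have [p' [hp' hrp]] := h _ hr'.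
  have [q' [hq' hrq]] :=
    refines_may (alpha := Some o) hq (must_may hR' hr').
  by exists (Both p' q'); split=> //; exists p' => //; exists q'.
- move=> p q o Q' _ hQ' [hp hq]; have [R' [hR' h]] := refines_must hq hQ'.
  exists R'; split=> // r' hr'; have [q' [hq' hrq]] := h _ hr'.
  have [p' [hp' hrp]] :=
    refines_may (alpha := Some o) hp (must_may hR' hr').
  by exists (Both p' q'); split=> //; exists p' => //; exists q'.
- move=> p q i P' hP' _ [/refines_must - /(_ _ _ hP') [R' [hR' h]] _].
  exists R'; split=> // r' /h [p' [hp' hr']].
  by exists (InL p'); split=> //; exists p'.
- move=> p q i Q' _ hQ' [_ /refines_must - /(_ _ _ hQ') [R' [hR' h]]].
  exists R'; split=> // r' /h [q' [hq' hr']].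
  by exists (InR q'); split=> //; exists q'.
- move=> p q i P' Q' hP' hQ' [hp hq].
  have [R' [hR' h]] := refines_must hp hP'.
  have [R'' [hR'' h'']] := refines_must hq hQ'.
  (* Input determinism of [R] merges the two answers of [r] into one target set. *)
  rewrite (input_det hR'' hR') in h''.
  exists R'; split=> // r' hr'.
  have [p' [hp' hrp]] := h _ hr'; have [q' [hq' hrq]] := h'' _ hr'.
  by exists (Both p' q'); split=> //; exists p' => //; exists q'.
Qed.

Lemma refines_components_consistent (R : MIA I O) (r : R) s :
  refines_components r s -> ~ inconsistent s.
Proof.
(* [r] is generalized because the [F3] case applies the induction hypothesis to a successor of
   [r]. *)
move=> hr hs; elim: hs R r hr => {s}.
- move=> p q o [P' hP'] hq R r [hrp hrq]; apply: hq.
  have [R' [hR' _]] := refines_must hrp hP'.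
  have [r' hr'] := must_nonempty hR'.
  have [q' [hq' _]] := refines_may (alpha := Some o) hrq (must_may hR' hr').
  by exists q'.
- move=> p q o hp [Q' hQ'] R r [hrp hrq]; apply: hp.
  have [R' [hR' _]] := refines_must hrq hQ'.
  have [r' hr'] := must_nonempty hR'.
  have [p' [hp' _]] := refines_may (alpha := Some o) hrp (must_may hR' hr').
  by exists p'.
- move=> p q a S hS _ IH R r hr.
  have [R' [hR' h]] := refines_components_must hr hS.
  have [r' hr'] := must_nonempty hR'.
  by have [s [hs hrs]] := h _ hr'; exact: IH hs _ _ hrs.
Qed.

(** Every intermediate state of a weak move in the conjunction must survive deletion; for a
    component embedded by [f] into consistent states this is automatic. *)
Lemma conj_weak_hat_lift (X : MIA I O) (f : X -> prod_state P Q) :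
  (forall x, ~ inconsistent (f x)) ->
  (forall x a x', may x a x' -> prod_may (f x) a (f x')) ->
  forall (s : conjunction P Q) x a x', proj1_sig s = f x ->
    weak_hat x a x' ->
    exists s' : conjunction P Q, weak_hat s a s' /\ proj1_sig s' = f x'.
Proof.
move=> fc fmay s x a x' es.
pose g y : conjunction P Q := exist (fun t => ~ inconsistent t) _ (fc y).
have -> : s = g x.
  case: s es => t ht /= et; subst t; congr exist; exact: Prop_irrelevance.
have epsg y : weak_eps x y -> weak_eps (g x) (g y).
  elim=> [u v huv|u|u v w _ huv _ hvw]; first exact/rt_step/fmay.
    exact: rt_refl.
  exact: rt_trans huv hvw.
case: a => [a|] /=; last by move=> /epsg h; exists (g x').
move=> [y [/epsg hy hyx]]; exists (g x'); split=> //; exists (g y); split=> //.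
exact: fmay.
Qed.

Lemma refines_components_may (R : MIA I O) (r : R) (s : conjunction P Q)
    (alpha : option O) r' :
  refines_components r (proj1_sig s) -> may r (out_tau I alpha) r' ->
  exists s', weak_hat s (out_tau I alpha) s' /\
    refines_components r' (proj1_sig s').
Proof.
case es : (proj1_sig s) => [p q|p|q] /=.
- move=> [hp hq] hr'.
  have [p' [hpp' hrp]] := refines_may hp hr'.
  have [q' [hqq' hrq]] := refines_may hq hr'.
  have hc : refines_components r' (Both p' q') by [].
  pose s' : conjunction P Q := exist (fun t => ~ inconsistent t) _
    (refines_components_consistent hc).
  (* From a pair, the product compresses weak moves of the components into one may-step, so only its
     endpoint must be consistent. *)
  have step : prod_may (proj1_sig s) (out_tau I alpha) (Both p' q') ->
      exists s'', weak_hat s (out_tau I alpha) s'' /\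
        refines_components r' (proj1_sig s'').
    by move=> h; exists s'; split=> //; exact: may_weak_hat.
  rewrite es in step.
  case: alpha hr' hpp' hqq' step => [o|] _ hpp' hqq' step.
    by apply: step; exact: (May3 (alpha := Some o)).
  (* If both sides answer tau by the empty path, the conjunction stays at [s]; otherwise the sides
     that move determine the rule. *)
  case: (weak_eps_cases hpp') (weak_eps_cases hqq') => [epp|hp'] [eqq|hq'].
  + by exists s; split; [exact: rt_refl|rewrite es epp eqq].
  + by apply: step; rewrite -epp; exact: May2.
  + by apply: step; rewrite -eqq; exact: May1.
  + by apply: step; exact: (May3 (alpha := None)).
- move=> hp hr'; have [p' [hpp' hrp]] := refines_may hp hr'.
  have fc x : ~ @inconsistent _ _ P Q (InL x) by move=> h; inversion h.
  have [s' [hs' es']] := conj_weak_hat_lift fc (@MayL _ _ P Q) es hpp'.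
  by exists s'; rewrite es'.
- move=> hq hr'; have [q' [hqq' hrq]] := refines_may hq hr'.
  have fc x : ~ @inconsistent _ _ P Q (InR x) by move=> h; inversion h.
  have [s' [hs' es']] := conj_weak_hat_lift fc (@MayR _ _ P Q) es hqq'.
  by exists s'; rewrite es'.
Qed.

Lemma refines_components_refines (R : MIA I O) (r : R) (s : conjunction P Q) :
  refines_components r (proj1_sig s) -> refines r s.
Proof.
move=> hr; exists (fun x t => refines_components x (proj1_sig t)); split=> //.
move=> x t hx; split=> [a _ [S [hS ->]]|alpha x' hx']; last first.
  exact: refines_components_may hx hx'.
have [R' [hR' h]] := refines_components_must hx hS.
exists R'; split=> // x' /h [t' [ht' hxt]].
(* The matching target survives deletion because [x'] refines its components. *)
by exists (exist _ t' (refines_components_consistent hxt)).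
Qed.

End Conjunction.

Theorem theorem4p7 (I O : Type) (P Q : MIA I O) (p : P) (q : Q) :
  ((exists (R : MIA I O) (r : R), refines r p /\ refines r q)
     <-> conj_defined p q) /\
  (forall (h : conj_defined p q) (R : MIA I O) (r : R),
     (refines r p /\ refines r q) <-> refines r (conj_at h)).
Proof.
have conj_lower (h : conj_defined p q) :
    refines (conj_at h) p /\ refines (conj_at h) q.
  by split; [exact: projects_left_refines|exact: projects_right_refines].
split=> [|h R r]; split.
- move=> [R [r hr]].
  exact: (refines_components_consistent (s := Both p q) hr).
- by move=> h; exists (conjunction P Q), (conj_at h).
- by move=> hr; exact: refines_components_refines.
- move=> hr; have [hp hq] := conj_lower h.
  by split; [exact: refines_trans hr hp|exact: refines_trans hr hq].
Qed.
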